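(* Let $q \geq 25$ be a prime power with $q \equiv 1 \pmod 4$, let $P_q$ be the Paley graph on $q$ vertices, and let $\ell(q) = \left\lfloor \frac{\sqrt{q}+3}{2}\right\rfloor$. If $\alpha(P_q) < \ell(q)$, then $z_{\ell(q)+1}(P_q) = z_{\ell(q)}(P_q) = \vartheta(P_q)$.
   Context: Paley graph: for a prime power $q$ with $q \equiv 1 \pmod 4$, $P_q$ is the simple undirected graph whose vertex set $V_q$ is the finite field $\mathbb{F}_q$ (elements labelled $0,\dots,q-1$), two vertices being adjacent iff their difference is a nonzero square in $\mathbb{F}_q$; $E_q$ is its edge set. $\alpha(G)$ denotes the stability number of $G$, the largest cardinality of a set of pairwise non-adjacent vertices. Lovász theta function: for a graph $G=(V,E)$ on $n$ vertices, $$\vartheta(G) = \max\left\{\mathbf{1}_n^T x : \begin{pmatrix} X & x\\ x^T & 1\end{pmatrix}\succeq 0,\ \mathrm{diag}(X)=x,\ X_{ij}=0\ \ \forall \{i,j\}\in E\right\},$$ where $x\in\mathbb{R}^n$, $X\in\mathbb{R}^{n\times n}$ is symmetric, $\mathbf{1}_n$ is the all-ones vector and $\mathrm{diag}(X)$ is the vector of diagonal entries of $X$. Squared stable set polytope: $\mathrm{STAB}^2(G) = \mathrm{conv}\{ss^T : s\in\{0,1\}^n,\ s_is_j=0\ \forall \{i,j\}\in E\}$. For $I\subseteq V$, $G_I$ is the subgraph of $G$ induced by $I$ and $X_I=(X_{ij})_{i,j\in I}$. Exact subgraph hierarchy: for $0 \le k\le n$, $z_k(G)$ is the optimal value of the semidefinite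 program $$\max\left\{\mathbf{1}_n^T x : \begin{pmatrix} X & x\\ x^T & 1\end{pmatrix}\succeq 0,\ \mathrm{diag}(X)=x,\ X_{ij}=0\ \ \forall \{i,j\}\in E\right\}$$ with the additional constraints $X_I\in \mathrm{STAB}^2(G_I)$ for all $I\subseteq V$ with $|I|=k$; for $k>n$, $z_k(G)=z_n(G)$. *)

(* Defs.v *)
From HB Require Import structures.
From mathcomp Require Import all_boot all_order all_algebra all_fingroup.
From mathcomp Require Import cyclic.
From mathcomp Require Import all_classical all_reals.

Set Implicit Arguments.
Unset Strict Implicit.
Unset Printing Implicit Defensive.

Import Order.TTheory GRing.Theory Num.Theory.

Local Open Scope ring_scope.

(** A graph on the vertex set {0, ..., n - 1} is given by its
    adjacency relation [e : rel 'I_n], understood to be symmetric and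
    irreflexive. *)

Definition induced (n : nat) (e : rel 'I_n) (I : {set 'I_n}) : rel 'I_#|I| :=
  fun i j => e (enum_val i) (enum_val j).

Arguments induced {n} e I _ _.

Definition stable (n : nat) (e : rel 'I_n) (S : {set 'I_n}) : bool :=
  [forall i in S, forall j in S, ~~ e i j].

Definition alpha (n : nat) (e : rel 'I_n) : nat :=
  \max_(S : {set 'I_n} | stable e S) #|S|.

(** [enum_val] plays the role of the labelling of the elements of the field by
    0, ..., #|F| - 1. *)
Definition paley (F : finFieldType) : rel 'I_#|F| :=
  fun i j => let d : F := enum_val i - enum_val j in
    (d != 0) && [exists y : F, y ^+ 2 == d].

Arguments paley F _ _ : clear implicits.

Definition psd (R : realType) (m : nat) (M : 'M[R]_m) : Prop :=
  M^T = M /\ forall v : 'cV[R]_m, 0 <= (v^T *m M *m v) 0 0.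

Definition conv (R : realType) (m n : nat) (A : set 'M[R]_(m, n)) :
    set 'M[R]_(m, n) :=
  [set X | exists (k : nat) (c : 'I_k -> R) (Y : 'I_k -> 'M[R]_(m, n)),
     [/\ forall i, 0 <= c i, \sum_i c i = 1, forall i, A (Y i)
       & X = \sum_i c i *: Y i] ]%classic.

Definition STAB2 (R : realType) (n : nat) (e : rel 'I_n) : set 'M[R]_n :=
  conv [set Y | exists s : 'cV[R]_n,
    [/\ forall i, s i 0 = 0 \/ s i 0 = 1,
        forall i j, e i j -> s i 0 * s j 0 = 0
      & Y = s *m s^T] ]%classic.

Definition theta_feasible (R : realType) (n : nat) (e : rel 'I_n)
    (X : 'M[R]_n) (x : 'cV[R]_n) : Prop :=
  [/\ psd (block_mx X x x^T (1%:M : 'M_1)),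
      forall i, X i i = x i 0
    & forall i j, e i j -> X i j = 0].

(** The feasible sets of the two programs are nonempty and compact, so that the
    suprema defining [theta] and [z] are attained maxima; that they are not the
    default value of [sup] is [has_sup_theta] and [has_sup_z] below. *)
Definition theta_values (R : realType) (n : nat) (e : rel 'I_n) : set R :=
  [set v | exists (X : 'M[R]_n) (x : 'cV[R]_n),
     theta_feasible e X x /\ v = \sum_i x i 0]%classic.

Arguments theta_values R {n} e _.

Definition theta (R : realType) (n : nat) (e : rel 'I_n) : R :=
  sup (theta_values R e).

Definition esc (R : realType) (n : nat) (e : rel 'I_n) (k : nat)
    (X : 'M[R]_n) : Prop :=
  forall I : {set 'I_n}, #|I| = k ->
    STAB2 (induced e I) (mxsub enum_val enum_val X).

(** [minn k n] implements the convention z_k = z_n for k > n. *)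
Definition z_values (R : realType) (k n : nat) (e : rel 'I_n) : set R :=
  [set v | exists (X : 'M[R]_n) (x : 'cV[R]_n),
     [/\ theta_feasible e X x, esc e (minn k n) X & v = \sum_i x i 0] ]%classic.

Arguments z_values R k {n} e _.

Definition z (R : realType) (k n : nat) (e : rel 'I_n) : R :=
  sup (z_values R k e).

(** [Num.truncn] is the floor here, its argument being nonnegative. *)
Definition ell (R : realType) (q : nat) : nat :=
  Num.truncn ((Num.sqrt (q%:R : R) + 3%:R) / 2%:R).

Lemma paley_irrefl (F : finFieldType) : irreflexive (paley F).
Proof. by move=> i; rewrite /paley subrr eqxx. Qed.

Lemma paley_sym (F : finFieldType) :
  #|F| = 1 %[mod 4] -> symmetric (paley F).
Proof.
move=> q1.
suff [a a2] : exists a : F, a ^+ 2 = -1.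
  have a0 : a != 0.
    by apply/eqP => a0; move: a2; rewrite a0 expr0n /= => /eqP;
       rewrite eq_sym oppr_eq0 oner_eq0.
  have sub (d : F) : [exists y : F, y ^+ 2 == d] -> [exists y : F, y ^+ 2 == - d].
    case/existsP=> y /eqP <-; apply/existsP; exists (a * y).
    by rewrite exprMn a2 mulN1r.
  move=> i j; rewrite /paley -(opprB (enum_val j)) oppr_eq0; congr (_ && _).
  by apply/idP/idP => /sub; rewrite ?opprK.
have /cyclicP[g gE] : cyclic [set: {unit F}] by exact: field_unit_group_cyclic.
have og : #[g]%g = #|F|.-1 by rewrite /order -gE card_finField_unit.
have F1 : (1 < #|F|)%N by apply/card_gt1P; exists 0, 1; rewrite eq_sym oner_eq0.
have d4 : (#|F|.-1 %/ 4 * 4)%N = #|F|.-1.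
  apply/divnK; rewrite -subn1 -eqn_mod_dvd ?(ltnW F1) //; exact/eqP.
set t := (#|F|.-1 %/ 4)%N in d4.
have t0 : (0 < t)%N by case: t d4 => // d4; move: F1; case: #|F| d4 => [|[]].
exists (FinRing.uval (g ^+ t)%g).
have b2 : (FinRing.uval (g ^+ t)%g ^+ 2) ^+ 2 = 1.
  rewrite -exprM -FinRing.val_unitX -expgM.
  have -> : (t * (2 * 2))%N = #[g]%g by rewrite og -d4.
  by rewrite expg_order.
have b1 : FinRing.uval (g ^+ t)%g ^+ 2 != 1.
  rewrite -FinRing.val_unitX -expgM; apply/eqP => h.
  have /eqP : (g ^+ (t * 2) = 1)%g by apply/val_inj.
  rewrite -order_dvdn og => /dvdn_leq; rewrite muln_gt0 t0 => /(_ isT).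
  by rewrite -d4 leq_pmul2l.
by move/eqP: b2; rewrite -subr_eq0 subr_sqr_1 mulf_eq0 subr_eq0 (negPf b1) /=
  addr_eq0 => /eqP.
Qed.

Lemma theta_feasible_le1 (R : realType) (n : nat) (e : rel 'I_n)
    (X : 'M[R]_n) (x : 'cV[R]_n) (i : 'I_n) :
  theta_feasible e X x -> x i 0 <= 1.
Proof.
case=> -[_ pos] dX _; have := pos (col_mx (delta_mx i 0) (- 1%:M)).
rewrite tr_col_mx mul_row_block mul_row_col !mulmxN mulmx1 trmx_delta.
rewrite linearN /= trmx1 !mulNmx !mul1mx mulmxBl -!rowE -!colE.
rewrite !mxE ?eqxx /= dX.
by rewrite subrr sub0r opprB subr_ge0.
Qed.

Lemma theta_feasible0 (R : realType) (n : nat) (e : rel 'I_n) :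
  theta_feasible e (0 : 'M[R]_n) 0.
Proof.
split; [split| |]; first by rewrite tr_block_mx !trmx0 trmx1.
- move=> v; rewrite -[v]vsubmxK tr_col_mx mul_row_block mul_row_col.
  rewrite trmx0 !mulmx0 !addr0 mul0mx !add0r mulmx1 mxE big_ord1 mxE.
  by rewrite -expr2 sqr_ge0.
- by move=> i; rewrite !mxE.
- by move=> i j _; rewrite mxE.
Qed.

Lemma STAB2_0 (R : realType) (n : nat) (e : rel 'I_n) :
  STAB2 e (0 : 'M[R]_n).
Proof.
exists 1, (fun=> 1), (fun=> 0).
split=> //; rewrite ?big_ord1 ?scaler0 // => _.
exists 0; split; last by rewrite mul0mx.
  by move=> i; left; rewrite mxE.
by move=> i j _; rewrite mxE mul0r.
Qed.

Lemma has_sup_theta (R : realType) (n : nat) (e : rel 'I_n) :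
  has_sup (theta_values R e).
Proof.
split.
  exists 0, 0, 0; split; first exact: theta_feasible0.
  by rewrite big1 // => i _; rewrite mxE.
exists n%:R => _ [X [x [fX ->]]].
have -> : n%:R = \sum_(i < n) (1 : R) by rewrite sumr_const card_ord.
by apply: ler_sum => i _; exact: theta_feasible_le1 fX.
Qed.

Lemma has_sup_z (R : realType) (k n : nat) (e : rel 'I_n) :
  has_sup (z_values R k e).
Proof.
split.
  exists 0, 0, 0; split; first exact: theta_feasible0.
    move=> I _; rewrite (_ : mxsub _ _ _ = 0); first exact: STAB2_0.
    by apply/matrixP => i j; rewrite !mxE.
  by rewrite big1 // => i _; rewrite mxE.
have [_ [M ubM]] := has_sup_theta R e.
by exists M => v [X [x [fX _ vE]]]; apply: ubM; exists X, x.
Qed.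

(* Main.v *)
(** With [s = sqrt q] and [Q] the Jacobsthal matrix of the quadratic character,
    [Q^2 = q I - J] and [Q J = 0], so that [P = I + Q/s - J/q] and
    [P' = I - Q/s - J/q] satisfy [P^2 = 2 P] and [P'^2 = 2 P'].  Hence [P] and
    [P'] are positive semidefinite: a multiple of [P] gives a dual certificate
    for [theta <= s], and a multiple of [P'] the feasible matrix
    [X = a I + b A'] of value [s], where [A'] is the adjacency matrix of the
    complement, [a = 1/s] and [b = 2/(s (s + 1))].

    It remains to see that [X] satisfies the exact subgraph constraints of order
    at most [ell + 1].  On such a subgraph, give weight [b] to stable sets that
    cover every nonadjacent pair exactly once, and use singletons to correct the
    diagonal; this works as long as each vertex lies in at most
    [ell - 1 <= a / b] of these sets.  A clique of size [ell], which could
    obstruct this, is excluded: multiplication by a nonsquare would turn it into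
    a stable set. *)

Require Import Defs.
From mathcomp Require Import all_boot all_order all_algebra.
From mathcomp Require Import all_classical all_reals.
From mathcomp Require Import fingroup cyclic ring lra.

Set Implicit Arguments.
Unset Strict Implicit.
Unset Printing Implicit Defensive.

Import Order.TTheory GRing.Theory Num.Theory.

Local Open Scope ring_scope.

(** * The quadratic character of a finite field of odd order *)

Lemma odd_card_two_neq0 (F : finFieldType) : odd #|F| -> 2%:R != 0 :> F.
Proof.
move=> oddF; apply/eqP => two0.
(* The order is taken in the additive group of [F], where Lagrange makes it divide the odd number
   [#|F|]. *)
have o1 : #[1%R : F]%g = 2.
  by apply: nt_prime_order => //; exact: (oner_neq0 F).
have : (#[1%R : F]%g %| #|[set: F]%G|)%N by rewrite order_dvdG ?inE.
by rewrite o1 cardsT dvdn2 oddF.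
Qed.

Definition quadc (R : realType) (F : finFieldType) (x : F) : R :=
  if x == 0 then 0 else if [exists y : F, y ^+ 2 == x] then 1 else - 1.

Section QuadraticCharacter.
Variables (R : realType) (F : finFieldType).
Hypothesis oddF : odd #|F|.
Local Notation chi := (@quadc R F).

Lemma quadc0 : chi 0 = 0. Proof. by rewrite /quadc eqxx. Qed.

Lemma quadc_sqr (y : F) : y != 0 -> chi (y ^+ 2) = 1.
Proof.
move=> y0; rewrite /quadc expf_eq0 (negPf y0) andbF.
by case: existsP => // -[]; exists y.
Qed.

Lemma quadc1 : chi 1 = 1.
Proof. by rewrite -(expr1n _ 2) quadc_sqr ?oner_neq0. Qed.

Lemma quadc_le1 (x : F) : chi x <= 1.
Proof. by rewrite /quadc; do 2?case: ifP => _; lra. Qed.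

Lemma quadcP (x : F) : x != 0 -> chi x = -1 \/ exists2 y, y != 0 & x = y ^+ 2.
Proof.
move=> x0; rewrite /quadc (negPf x0); case: existsP => [[y /eqP yx]|_]; last by left.
by right; exists y => //; apply: contraNneq x0 => y0; rewrite -yx y0 expr0n.
Qed.

(** The nonzero roots come in pairs [y], [- y], distinct because [2] is nonzero in [F]. *)
Lemma sqrt_count (x : F) : 1 + chi x = \sum_(y : F | y ^+ 2 == x) 1.
Proof.
have [->|x0] := eqVneq x 0.
  rewrite quadc0 addr0 (big_pred1 0) // => y.
  by rewrite expf_eq0.
have [c1|[y y0 ->]] := quadcP x0.
  rewrite c1 subrr big_pred0 // => y; apply/negP => /eqP yx.
  have y0 : y != 0 by apply: contraNneq x0 => y0; rewrite -yx y0 expr0n.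
  by move: c1; rewrite -yx quadc_sqr //; lra.
have yNy : - y != y.
  rewrite -subr_eq0 -opprD oppr_eq0 -mulr2n -mulr_natl mulf_eq0 (negPf y0) orbF.
  exact: odd_card_two_neq0.
rewrite quadc_sqr // (bigD1 y) //= (bigD1 (- y)) /=; last by rewrite sqrrN eqxx.
rewrite big1 ?addr0 // => z /andP[/andP[]].
by rewrite eqf_sqr => /orP[]/eqP->; rewrite eqxx //= andbF.
Qed.

(** Summing [sqrt_count] over all [x] counts each [y] once, at [x = y ^+ 2]. *)
Lemma sum_quadc : \sum_x chi x = 0.
Proof.
have : \sum_(x : F) (1 + chi x) = \sum_(y : F) 1.
  rewrite [RHS](partition_big (fun y : F => y ^+ 2) xpredT) //=.
  by apply: eq_bigr => x _; rewrite sqrt_count.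
rewrite big_split /=; lra.
Qed.

Lemma sum_quadc_mul (a : F) : a != 0 -> \sum_x chi (a * x) = 0.
Proof.
move=> a0; rewrite -[RHS]sum_quadc [RHS](reindex (fun x => a * x)) //=.
by exists (fun x => a^-1 * x) => x _; rewrite ?mulKf ?mulVKf.
Qed.

Lemma quadc_sqrM (y x : F) : y != 0 -> chi (y ^+ 2 * x) = chi x.
Proof.
move=> y0; have [->|x0] := eqVneq x 0; first by rewrite mulr0.
rewrite /quadc mulf_eq0 expf_eq0 (negPf y0) (negPf x0) /=; congr (if _ then _ else _).
apply/existsP/existsP => -[w /eqP wx].
  by exists (w / y); rewrite expr_div_n wx mulrC mulKf ?expf_neq0.
by exists (y * w); rewrite exprMn wx.
Qed.

(* For a nonsquare [a], the terms [chi (a * x) + chi x] are nonpositive and sum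
   to [0], so they vanish. *)
Lemma quadcM (a x : F) : chi (a * x) = chi a * chi x.
Proof.
have [->|a0] := eqVneq a 0; first by rewrite mul0r quadc0 mul0r.
have [ca|[y y0 ->]] := quadcP a0; last by rewrite quadc_sqrM // quadc_sqr // mul1r.
have le0 z : chi (a * z) + chi z <= 0.
  have [->|z0] := eqVneq z 0; first by rewrite mulr0 !quadc0 addr0.
  have [->|[y y0 ->]] := quadcP z0; first by rewrite subr_le0 quadc_le1.
  by rewrite mulrC quadc_sqrM // ca quadc_sqr // addNr.
have s0 : \sum_z - (chi (a * z) + chi z) = 0.
  by rewrite sumrN big_split /= sum_quadc_mul // sum_quadc addr0 oppr0.
have nn z : true -> 0 <= - (chi (a * z) + chi z) by rewrite oppr_ge0.
have /eqP : - (chi (a * x) + chi x) = 0 by apply: (psumr_eq0P nn s0).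
by rewrite oppr_eq0 addr_eq0 ca mulN1r => /eqP.
Qed.

(** Otherwise [chi] is nonnegative with sum [0], hence zero everywhere, against [quadc1]. *)
Lemma exists_nonsquare : exists a : F, chi a = -1.
Proof.
apply: contrapT => noa.
have pos x : 0 <= chi x.
  have [->|x0] := eqVneq x 0; first by rewrite quadc0.
  have [c1|[y y0 ->]] := quadcP x0; first by case: noa; exists x.
  by rewrite quadc_sqr.
have : chi 1 = 0 by apply: (psumr_eq0P (fun z _ => pos z) sum_quadc).
by rewrite quadc1; lra.
Qed.

(** For nonzero [x], [x * (x + c)] is [x ^+ 2 * (1 + c / x)], and [1 + c / x] runs over every
    element except [1]. So the sum is that of all [chi y] less [chi 1]. *)
Lemma sum_quadc_shift (c : F) : c != 0 -> \sum_x chi x * chi (x + c) = -1.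
Proof.
move=> c0; rewrite (bigD1 0) //= quadc0 mul0r add0r.
have -> : \sum_(x | x != 0) chi x * chi (x + c) =
          \sum_(x | x != 0) chi (1 + c / x).
  apply: eq_bigr => x x0; rewrite -quadcM -[RHS](quadc_sqrM _ x0).
  by congr chi; field.
have -> : \sum_(x | x != 0) chi (1 + c / x) = \sum_(y | y != 1) chi y.
  rewrite [RHS](reindex (fun x => 1 + c / x)) /=.
    apply: eq_bigl => x.
    by rewrite -[in RHS]subr_eq0 [1 + _]addrC addrK mulf_eq0 (negPf c0) invr_eq0.
  exists (fun y => c / (y - 1)) => y _.
    by rewrite addrC addKr invf_div mulrC divfK.
  by rewrite invf_div mulrC divfK // addrC subrK.
by have := sum_quadc; rewrite (bigD1 1) //= quadc1; lra.
Qed.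

End QuadraticCharacter.

(** * Gram matrices and positive semidefiniteness *)

Lemma psd_gram (R : realType) (m p : nat) (B : 'M[R]_(m, p)) : psd (B *m B^T).
Proof.
split=> [|v]; first by rewrite trmx_mul trmxK.
rewrite mulmxA -mulmxA -[v^T *m B]trmxK trmx_mul trmxK mxE.
by apply: sumr_ge0 => k _; rewrite [X in X * _]mxE -expr2 sqr_ge0.
Qed.

Lemma psdZ (R : realType) (m : nat) (c : R) (M : 'M[R]_m) :
  0 <= c -> psd M -> psd (c *: M).
Proof.
move=> c0 [symM posM]; split=> [|v]; first by rewrite linearZ /= symM.
by rewrite -scalemxAr -scalemxAl mxE mulr_ge0.
Qed.

(** The trace is the sum of the values of the form [M] at the columns of [B]. This is weak duality,
    with the dual certificate given as a Gram matrix. *)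
Lemma psd_trace_gram (R : realType) (m p : nat) (M : 'M[R]_m) (B : 'M[R]_(m, p)) :
  psd M -> 0 <= \tr (M *m (B *m B^T)).
Proof.
move=> [_ posM]; rewrite mulmxA mxtrace_mulC mulmxA; apply: sumr_ge0 => k _.
have := posM (col k B); rewrite tr_col -row_mul [X in 0 <= X -> _]mxE.
by rewrite mxE; under eq_bigr do rewrite [row _ _ _ _]mxE [col _ _ _ _]mxE.
Qed.

(** * Jacobsthal matrix and theta number of the Paley graph *)

Section PaleyMatrices.
Variables (R : realType) (F : finFieldType).
Hypothesis card1 : #|F| = 1 %[mod 4].
Local Notation q := #|F|.
Local Notation chi := (@quadc R F).
Local Notation J := (const_mx 1 : 'M[R]_q).
Let s : R := Num.sqrt q%:R.

Lemma paley_odd : odd q.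
Proof.
have : (q %% 4 = 1)%N by rewrite card1.
by rewrite {2}(divn_eq q 4) => ->; rewrite oddD oddM andbF.
Qed.

(** That [-1] is a square is read off from the symmetry of adjacency between [x] and [0]. *)
Lemma quadcN (x : F) : chi (- x) = chi x.
Proof.
have sym := paley_sym card1.
rewrite /quadc oppr_eq0; case: eqVneq => // x0.
have := sym (enum_rank x) (enum_rank 0).
by rewrite /paley !enum_rankK subr0 sub0r oppr_eq0 x0 /= => ->.
Qed.

Lemma quadc_paley (i j : 'I_q) : i != j ->
  chi (enum_val i - enum_val j) = 2%:R * (paley F i j)%:R - 1.
Proof.
move=> ij; have d0 : enum_val i - enum_val j != 0 :> F.
  by rewrite subr_eq0; apply: contra_neq ij => /enum_val_inj.
by rewrite /quadc /paley d0 (negPf d0) /=; case: ifP => _; rewrite ?mulr1 ?mulr0; lra.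
Qed.

Definition jacobsthal : 'M[R]_q := \matrix_(i, j) chi (enum_val i - enum_val j).

Lemma jacobsthalT : jacobsthal^T = jacobsthal.
Proof. by apply/matrixP=> i j; rewrite !mxE -quadcN opprB. Qed.

Lemma big_shift_enum_val (G : F -> R) (c : F) :
  \sum_(k < q) G (enum_val k + c) = \sum_x G x.
Proof.
rewrite [RHS](reindex (fun k : 'I_q => enum_val k + c)) //=.
exists (fun x => enum_rank (x - c)) => x _; first by rewrite addrK enum_valK.
by rewrite enum_rankK subrK.
Qed.

Lemma jacobsthal_ones : jacobsthal *m J = 0.
Proof.
apply/matrixP=> i j; rewrite !mxE -[RHS](sum_quadc R paley_odd).
rewrite -(big_shift_enum_val _ (- enum_val i)); apply: eq_bigr => k _.
by rewrite !mxE mulr1 -quadcN opprB.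
Qed.

(** Off the diagonal an entry is a shifted autocorrelation of [chi], hence [-1]; on the diagonal it
    counts the nonzero elements. *)
Lemma jacobsthal_sqr : jacobsthal *m jacobsthal = q%:R%:M - J.
Proof.
apply/matrixP=> i j; rewrite !mxE.
have -> : \sum_k jacobsthal i k * jacobsthal k j =
          \sum_x chi x * chi (x + (enum_val i - enum_val j)).
  rewrite -(big_shift_enum_val _ (- enum_val i)); apply: eq_bigr => k _.
  by rewrite !mxE -quadcN opprB addrA subrK.
have [->|ij] := eqVneq i j; last first.
  rewrite sum_quadc_shift ?mulr0n ?sub0r //; first exact: paley_odd.
  by rewrite subr_eq0; apply: contra_neq ij => /enum_val_inj.
rewrite subrr (bigD1 0) //= quadc0 mul0r add0r mulr1n.
rewrite (eq_bigr (fun=> 1)) => [|x x0]; last first.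
  rewrite addr0 -quadcM; last exact: paley_odd.
  by rewrite -expr2 quadc_sqr.
have : \sum_(x : F) (1 : R) = q%:R by rewrite sumr_const.
by rewrite (bigD1 0) //= => <-; rewrite [1 + _]addrC addrK.
Qed.

Lemma paley_q_gt0 : 0 < q%:R :> R.
Proof. by rewrite ltr0n; apply/card_gt0P; exists 0. Qed.

Lemma paley_s_gt0 : 0 < s. Proof. by rewrite sqrtr_gt0 paley_q_gt0. Qed.

Lemma paley_s_sqr : s ^+ 2 = q%:R.
Proof. by rewrite sqr_sqrtr // ltW // paley_q_gt0. Qed.

(** For [eps] equal to [1] or [-1] this is twice the orthogonal projection onto the eigenspace of
    [jacobsthal] for the eigenvalue [eps * s]. *)
Definition paley_proj (eps : R) : 'M[R]_q :=
  1%:M + (eps / s) *: jacobsthal - q%:R^-1 *: J.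

Lemma paley_projT eps : (paley_proj eps)^T = paley_proj eps.
Proof.
rewrite /paley_proj linearB linearD /= !linearZ /= trmx1 jacobsthalT.
by rewrite trmx_const.
Qed.

Lemma paley_proj_sqr eps : eps ^+ 2 = 1 ->
  paley_proj eps *m paley_proj eps = 2%:R *: paley_proj eps.
Proof.
move=> e2.
have JJ : J *m J = q%:R *: J.
  apply/matrixP=> i j; rewrite !mxE.
  by under eq_bigr do rewrite !mxE mulr1; rewrite sumr_const card_ord mulr1.
have JQ : J *m jacobsthal = 0.
  by rewrite -[LHS]trmxK trmx_mul jacobsthalT trmx_const jacobsthal_ones trmx0.
rewrite /paley_proj !(mulmxDl, mulmxDr, mulmxN, mulNmx, mul1mx, mulmx1).
rewrite -!(scalemxAl, scalemxAr) jacobsthal_ones jacobsthal_sqr JQ JJ.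
have s0 : s != 0 by rewrite gt_eqF ?paley_s_gt0.
have q0 : q%:R != 0 :> R by rewrite gt_eqF ?paley_q_gt0.
apply/matrixP=> i j; rewrite !mxE -paley_s_sqr.
have e1 : eps * eps = 1 by rewrite -expr2.
rewrite -[s ^+ 2 *+ _]mulr_natr; set d := (i == j)%:R.
have -> : eps / s * (eps / s * (s ^+ 2 * d - 1)) = eps * eps * (d - (s ^+ 2)^-1).
  by field.
by rewrite e1; field.
Qed.

(** The coefficients make the diagonal [1] and the entries zero on nonedges for [eps = 1], on edges
    for [eps = -1]. The term in [J] is what a border of entries [1] or [-1] with corner [s] removes
    in the Schur complement. *)
Definition paley_lift (eps : R) : 'M[R]_q :=
  (s / (s + 1)) *: paley_proj eps + s^-1 *: J.

Lemma paley_liftE (eps : R) i j : eps = 1 \/ eps = -1 ->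
  paley_lift eps i j = if i == j then 1 else
   if eps == 1 then 2%:R / (s + 1) * (paley F i j)%:R
   else 2%:R / (s + 1) * (~~ paley F i j)%:R.
Proof.
have s0 := paley_s_gt0.
have sn0 : s != 0 by rewrite gt_eqF.
have s1 : s + 1 != 0 by rewrite gt_eqF //; lra.
rewrite !mxE -paley_s_sqr; have [->|ij] := eqVneq i j.
  by rewrite subrr quadc0 mulr1n => _; field; rewrite s1 sn0.
rewrite mulr0n quadc_paley // => -[->|->].
  by rewrite eqxx; case: (paley F i j); rewrite /= ?mulr0n ?mulr1n; field; rewrite s1 sn0.
rewrite ifF; last by apply/eqP; lra.
by case: (paley F i j); rewrite /= ?mulr0n ?mulr1n; field; rewrite s1 sn0.
Qed.

(* Used with [(eps, t) = (1, -1)] for the dual certificate and [(-1, 1)] for the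
   primal optimum scaled by [s]. *)
Lemma paley_lift_gram (eps t : R) : eps = 1 \/ eps = -1 -> t ^+ 2 = 1 ->
  exists B : 'M[R]_(q + 1),
  block_mx (paley_lift eps) (const_mx t) (const_mx t)^T (s%:M : 'M_1) = B *m B^T.
Proof.
move=> he t2; have s0 := paley_s_gt0; have sn0 : s != 0 by rewrite gt_eqF.
have e2 : eps ^+ 2 = 1 by case: he => ->; rewrite ?sqrrN expr1n.
(* Since [paley_proj eps] squares to twice itself, this [c] gives [c *: paley_proj eps] the Gram
   matrix [(s / (s + 1)) *: paley_proj eps]. The second block column of the witness, built from [r],
   yields the border, the corner and the term in [J]. *)
pose c := Num.sqrt (s / (2%:R * (s + 1))); pose r := Num.sqrt s.
have c2 : c * c = s / (2%:R * (s + 1)).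
  by rewrite -expr2 sqr_sqrtr //; apply: divr_ge0; lra.
have r2 : r * r = s by rewrite -expr2 sqr_sqrtr // ltW.
have r0 : r != 0 by rewrite gt_eqF // sqrtr_gt0.
exists (block_mx (c *: paley_proj eps) (const_mx (t / r)) 0 r%:M).
rewrite tr_block_mx mulmx_block trmx0 !mul0mx mulmx0 !add0r.
rewrite linearZ /= paley_projT -scalemxAl -scalemxAr paley_proj_sqr // tr_scalar_mx.
rewrite -scalar_mxM r2 mul_mx_scalar mul_scalar_mx !trmx_const !scalemx_const.
have -> : r * (t / r) = t by field.
congr (block_mx _ _ _ _).
rewrite /paley_lift !scalerA c2; congr (_ *: _ + _); first by field; rewrite gt_eqF //; lra.
apply/matrixP => i j; rewrite !mxE big_ord1 !mxE.
have -> : t / r * (t / r) = t ^+ 2 / (r * r) by field.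
by rewrite t2 r2 mulr1 mul1r.
Qed.

(** Off the diagonal [paley_lift 1] lives on edges, where [X] vanishes, so its trace against [X] is
    the objective value. Each border contributes minus that value and the corner [s], so
    nonnegativity of the total trace is the bound. *)
Lemma paley_theta_le (X : 'M[R]_q) (x : 'cV[R]_q) :
  theta_feasible (paley F) X x -> \sum_i x i 0 <= s.
Proof.
move=> [psdM dX eX].
have [|B BE] := @paley_lift_gram 1 (-1) (or_introl erefl); first by rewrite sqrrN expr1n.
have := psd_trace_gram B psdM; rewrite -BE mulmx_block mxtrace_block.
rewrite !mxtraceD.
have -> : \tr (X *m paley_lift 1) = \sum_i x i 0.
  apply: eq_bigr => i _; rewrite mxE (bigD1 i) //= big1 => [|j ji].
    by rewrite addr0 paley_liftE ?eqxx ?mulr1 //; left.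
  rewrite paley_liftE; last by left.
  rewrite (negPf ji) eqxx (paley_sym card1).
  by case e: (paley F i j); rewrite ?mulr0 // eX ?mul0r.
have -> : \tr (x *m (const_mx (-1))^T) = - \sum_i x i 0.
  rewrite mxtrace_mulC trace_mx11 mxE -sumrN; apply: eq_bigr => i _.
  by rewrite !mxE mulN1r.
have -> : \tr (x^T *m const_mx (-1)) = - \sum_i x i 0.
  rewrite trace_mx11 mxE -sumrN; apply: eq_bigr => i _.
  by rewrite !mxE mulrN1.
by rewrite mul1mx trace_mx11 mxE mulr1n; lra.
Qed.

Definition paley_opt : 'M[R]_q := s^-1 *: paley_lift (-1).

Lemma paley_optE i j : paley_opt i j = if i == j then s^-1
  else 2%:R / (s * (s + 1)) * (~~ paley F i j)%:R.
Proof.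
have s0 := paley_s_gt0.
rewrite mxE paley_liftE; last by right.
case: ifP => _; first by rewrite mulr1.
rewrite ifF; last by apply/eqP; lra.
by rewrite invfM !mulrA [s^-1 * 2%:R]mulrC.
Qed.

Lemma paley_opt_feasible :
  theta_feasible (paley F) paley_opt (const_mx s^-1).
Proof.
have s0 := paley_s_gt0.
split=> [|i|i j eij]; last 2 first.
- by rewrite paley_optE eqxx mxE.
- rewrite paley_optE ifF ?eij ?mulr0 //.
  by apply/negP => /eqP ij; move: eij; rewrite ij paley_irrefl.
have [B BE] := @paley_lift_gram (-1) 1 (or_intror erefl) (expr1n _ _).
have -> : block_mx paley_opt (const_mx s^-1) (const_mx s^-1)^T 1%:M =
    s^-1 *: (B *m B^T).
  rewrite -BE scale_block_mx -linearZ /= scalemx_const mulr1; congr block_mx.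
  by rewrite scale_scalar_mx mulVf // gt_eqF.
by apply: psdZ (psd_gram B); rewrite invr_ge0 ltW.
Qed.

End PaleyMatrices.

(** * Exact covers of nonadjacent pairs by stable sets *)

Lemma conv_sum_le1 (R : realType) (m n : nat) (A : set 'M[R]_(m, n))
    (T : finType) (c : T -> R) (Y : T -> 'M[R]_(m, n)) :
  (forall t, 0 <= c t) -> \sum_t c t <= 1 -> A 0 -> (forall t, A (Y t)) ->
  conv A (\sum_t c t *: Y t).
Proof.
move=> c0 c1 A0 AY.
exists #|T|.+1.
(* Index [ord0] carries the missing weight and the matrix [0]. *)
exists (fun k => if unlift ord0 k is Some t then c (enum_val t) else 1 - \sum_t c t).
exists (fun k => if unlift ord0 k is Some t then Y (enum_val t) else 0).
have reidx (V : nmodType) (G : T -> V) : \sum_(k < #|T|) G (enum_val k) = \sum_t G t.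
  by rewrite [RHS](reindex _ (onW_bij _ (@enum_val_bij T))).
split.
- by move=> k; case: unliftP => [t|] _ //; rewrite subr_ge0.
- rewrite big_ord_recl unlift_none.
  rewrite (eq_bigr (fun k : 'I_#|T| => c (enum_val k))) => [|k _]; last by rewrite liftK.
  by rewrite reidx subrK.
- by move=> k; case: unliftP.
- rewrite big_ord_recl unlift_none scaler0 add0r.
  rewrite [RHS](eq_bigr (fun k : 'I_#|T| => c (enum_val k) *: Y (enum_val k)));
    last by move=> k _; rewrite liftK.
  by rewrite (reidx _ (fun t => c t *: Y t)).
Qed.

Section StableCovers.
Variables (m : nat) (e : rel 'I_m).
Hypotheses (e_sym : symmetric e) (e_irr : irreflexive e).
Implicit Types (S T C : {set 'I_m}) (Fam : {set {set 'I_m}}).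

Lemma stableP S : reflect {in S &, forall i j, ~~ e i j} (stable e S).
Proof.
apply: (iffP forall_inP) => [h i j iS jS|h i iS]; first exact: (forall_inP (h i iS)).
by apply/forall_inP => j; apply: h.
Qed.

Lemma card_incidence Fam : (forall S, S \in Fam -> (0 < #|S|)%N) ->
  (#|Fam| <= \sum_(i < m) #|[set S in Fam | i \in S]|)%N.
Proof.
move=> ne; rewrite -sum1_card.
under [leqRHS]eq_bigr => i _ do rewrite -sum1dep_card big_mkcondr.
rewrite exchange_big /=; apply: leq_sum => S /ne.
by rewrite -big_mkcond sum1_card.
Qed.

(** Each member of [Fam] gets weight [b], and the singleton of [i] gets what the diagonal entry
    still lacks. By [card_incidence] the total weight is at most [m%:R * a]; the remainder goes to
    the empty set. *)
Lemma STAB2_cover (R : realType) Fam (a b : R) (X : 'M[R]_m) :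
  (forall S, S \in Fam -> stable e S && (0 < #|S|)%N) ->
  (forall i j, i != j -> #|[set S in Fam | (i \in S) && (j \in S)]| = ~~ e i j) ->
  0 <= b -> (forall i, b * #|[set S in Fam | i \in S]|%:R <= a) -> m%:R * a <= 1 ->
  (forall i j, X i j = if i == j then a else b * (~~ e i j)%:R) ->
  STAB2 e X.
Proof.
move=> FamP cov b0 deg ma1 XE.
pose ind S : 'cV[R]_m := \col_i (i \in S)%:R.
pose c (t : {set 'I_m} + 'I_m) : R := match t with
  (* The disjoint sum lets a singleton occur both as a member of [Fam] and as a correction. *)
  | inl U => if U \in Fam then b else 0
  | inr i => a - b * #|[set S in Fam | i \in S]|%:R end.
pose Y (t : {set 'I_m} + 'I_m) : 'M[R]_m := match t with
  | inl U => if U \in Fam then ind U *m (ind U)^T else 0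
  | inr i => ind [set i] *m (ind [set i])^T end.
have sumb (P : pred {set 'I_m}) : \sum_(S in Fam) b * (P S)%:R =
    b * #|[set S in Fam | P S]|%:R.
  rewrite -mulr_sumr -natr_sum; congr (_ * _%:R).
  by rewrite -sum1dep_card big_mkcondr; apply: eq_bigr => S _; case: (P S).
have -> : X = \sum_t c t *: Y t.
  apply/matrixP => i j; rewrite summxE big_sumType /= XE.
  have -> : \sum_S (c (inl S) *: Y (inl S)) i j =
      b * #|[set S in Fam | (i \in S) && (j \in S)]|%:R.
    rewrite -sumb [RHS]big_mkcond; apply: eq_bigr => S _ /=.
    case: ifP => _; last by rewrite scale0r mxE.
    by rewrite !mxE big_ord1 !mxE -natrM mulnb.
  rewrite (bigD1 i) //= big1 => [|k ki]; last first.
    by rewrite !mxE big_ord1 !mxE inE eq_sym (negPf ki) mul0r mulr0.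
  rewrite !mxE big_ord1 !mxE !inE eqxx mul1r addr0 [j == i]eq_sym.
  have [<-|ij] := eqVneq i j; last by rewrite cov // mulr0 addr0.
  rewrite mulr1; under eq_finset do rewrite andbb.
  by rewrite addrC subrK.
apply: conv_sum_le1.
- by case=> [S|i] /=; [case: ifP | rewrite subr_ge0].
- rewrite big_sumType /= sumrB -mulr_sumr -natr_sum.
  rewrite -big_mkcond /= !sumr_const card_ord -[b *+ _]mulr_natr -[a *+ m]mulr_natl.
  apply: le_trans ma1; rewrite addrCA gerDl subr_le0 ler_wpM2l // ler_nat.
  by apply: card_incidence => S /FamP/andP[].
- exists 0; split=> [i|i j _|]; last by rewrite mul0mx.
    by left; rewrite mxE.
  by rewrite mxE mul0r.
have gen S : stable e S -> [set Y | exists s : 'cV[R]_m,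
    [/\ forall i, s i 0 = 0 \/ s i 0 = 1,
        forall i j, e i j -> s i 0 * s j 0 = 0
      & Y = s *m s^T] ]%classic (ind S *m (ind S)^T).
  move=> /stableP stS; exists (ind S); split=> // [i|i j eij].
    by rewrite mxE; case: (i \in S); [right|left].
  rewrite !mxE -natrM mulnb; case: andP => // -[iS jS].
  by have := stS i j iS jS; rewrite eij.
case=> [S|i] /=; last by apply: gen; apply/stableP => k l /set1P-> /set1P->; rewrite e_irr.
case: ifP => [/FamP/andP[stS _]|_]; first exact: gen.
exists 0; split=> [i|i j _|]; last by rewrite mul0mx.
  by left; rewrite mxE.
by rewrite mxE mul0r.
Qed.

Definition coneighbours (i : 'I_m) : {set 'I_m} := [set j | (j != i) && ~~ e i j].

Definition stable_pairs : {set {set 'I_m}} := [set S : {set 'I_m} | (#|S| == 2) && stable e S].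

Lemma stable_pairE S i j : S \in stable_pairs -> i \in S -> j \in S -> i != j ->
  S = [set i; j].
Proof.
rewrite inE => /andP[/eqP S2 _] iS jS ij; apply/eqP.
rewrite eq_sym eqEcard S2 cards2 ij andbT.
by apply/fintype.subsetP => k /set2P[]->.
Qed.

Lemma stable_set2 i j : stable e [set i; j] = ~~ e i j.
Proof.
apply/stableP/idP => [h|ij k l]; first by apply: h; rewrite ?set21 ?set22.
by move=> /set2P[]-> /set2P[]->; rewrite ?e_irr // e_sym.
Qed.

Lemma stable_pairs_cover i j : i != j ->
  [set S in stable_pairs | (i \in S) && (j \in S)] =
  if e i j then finset.set0 else [set [set i; j]].
Proof.
move=> ij; apply/setP => S; rewrite inE; apply/andP/idP => [[Sp /andP[iS jS]]|].
  have SE := stable_pairE Sp iS jS ij.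
  by move: Sp; rewrite inE SE stable_set2 => /andP[_ /negPf->]; rewrite inE.
case: ifP => nij; rewrite inE // => /eqP->.
by rewrite inE cards2 ij stable_set2 nij set21 set22.
Qed.

Lemma stable_pairs_at i S : S \in stable_pairs -> i \in S ->
  exists2 j, j \in coneighbours i & S = [set i; j].
Proof.
move=> Sp iS; have /andP[/eqP S2 _] : (#|S| == 2) && stable e S by move: Sp; rewrite inE.
have [j] : exists j, j \in S :\ i.
  by apply/card_gt0P; have := cardsD1 i S; rewrite iS S2 add1n => -[<-].
rewrite !inE => /andP[ji jS]; have SE := stable_pairE Sp iS jS.
exists j; last by apply: SE; rewrite eq_sym.
by move: Sp; rewrite SE 1?eq_sym // !inE stable_set2 ji => /andP[].
Qed.

(** Removing [i] maps the pairs through [i] injectively to singletons of coneighbours. *)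
Lemma stable_pairs_degree i :
  (#|[set S in stable_pairs | i \in S]| <= #|coneighbours i|)%N.
Proof.
rewrite -(card_in_imset (f := fun S : {set 'I_m} => S :\ i)); last first.
  move=> S T; rewrite !inE => /andP[_ iS] /andP[_ iT] ST.
  by rewrite -(finset.setD1K iS) ST finset.setD1K.
apply: leq_trans (leq_imset_card (fun j : 'I_m => [set j]) _).
apply/subset_leq_card/fintype.subsetP => _ /imsetP[S + ->].
rewrite inE => /andP[Sp iS]; have [j jn ->] := stable_pairs_at Sp iS.
apply/imsetP; exists j => //; apply/setP => k; rewrite !inE.
by case: eqVneq => // ->; apply/esym/negbTE; move: jn; rewrite inE eq_sym => /andP[].
Qed.

Variables (T : {set 'I_m}).
Hypotheses (stT : stable e T) (T3 : (2 < #|T|)%N).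

(** The pairs inside [T] are traded for [T] itself, which covers each of them once. *)
Definition pairs_and_block : {set {set 'I_m}} :=
  T |: [set S in stable_pairs | ~~ (S \subset T)].

Lemma pairs_and_block_cover i j : i != j ->
  #|[set S in pairs_and_block | (i \in S) && (j \in S)]| = ~~ e i j.
Proof.
move=> ij.
have [/andP[iT jT]|nT] := boolP ((i \in T) && (j \in T)).
  rewrite (stableP _ stT) //=.
  rewrite (_ : [set _ in _ | _] = [set T]) ?cards1 //; apply/setP => S.
  rewrite !inE; have [->|_] /= := eqVneq S T; first by rewrite iT jT.
  apply/negP => /andP[/andP[Sp nST] /andP[iS jS]]; move/negP: nST; apply.
  have Sp' : S \in stable_pairs by rewrite inE.
  rewrite (stable_pairE Sp' iS jS ij).
  by apply/fintype.subsetP => k /set2P[]->.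
rewrite (_ : [set _ in _ | _] = [set S in stable_pairs | (i \in S) && (j \in S)]).
  by rewrite stable_pairs_cover //; case: (e i j); rewrite ?cards0 ?cards1.
apply/setP => S; rewrite !inE; have [->|_] /= := eqVneq S T.
  by rewrite (negPf nT) andbF.
case: (boolP (S \subset T)) => [/fintype.subsetP ST|_]; last by rewrite andbT.
rewrite andbF /=; apply/esym/negP => /andP[_ /andP[/ST iT /ST jT]].
by rewrite iT jT in nT.
Qed.

Lemma pairs_and_block_degree_out i : i \notin T ->
  (#|[set S in pairs_and_block | i \in S]| <= #|coneighbours i|)%N.
Proof.
move=> iT; apply: leq_trans (stable_pairs_degree i).
apply/subset_leq_card/fintype.subsetP => S; rewrite !inE.
have [->|_] := eqVneq S T; first by rewrite (negPf iT) andbF.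
by case/andP => /andP[-> _] ->.
Qed.

(** At [i] the single set [T] replaces at least two pairs, one for each other vertex of [T]; hence
    the strict inequality. *)
Lemma pairs_and_block_degree_in i : i \in T ->
  (#|[set S in pairs_and_block | i \in S]| < #|coneighbours i|)%N.
Proof.
move=> iT; apply: (@leq_ltn_trans (#|coneighbours i :\: T|).+1).
  apply: (@leq_trans #|T |: [set [set i; j] | j in coneighbours i :\: T]|).
    apply/subset_leq_card/fintype.subsetP => S; rewrite inE in_setU1 in_setU1.
    case/andP => /orP[->//|]; rewrite inE => /andP[Sp nST] iS.
    have [j jn SE] := stable_pairs_at Sp iS; apply/orP; right.
    apply/imsetP; exists j => //; rewrite inE jn andbT.
    apply: contra nST => jT; rewrite SE.
    by apply/fintype.subsetP => k /set2P[]->.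
  rewrite cardsU1; apply: leq_add (leq_b1 _) (leq_imset_card _ _).
rewrite -(cardsID T (coneighbours i)) -add2n leq_add2r.
apply: (@leq_trans #|T :\ i|).
  by move: T3; rewrite (cardsD1 i) iT.
apply/subset_leq_card/fintype.subsetP => j; rewrite !inE => /andP[ji jT].
by rewrite ji jT (stableP _ stT).
Qed.

End StableCovers.

(* A vertex nonadjacent to all [d.+1] others lies in too many pairs.  Merging the
   pairs inside a maximum stable set [T], which contains all such vertices, into
   [T] itself repairs this if [#|T| >= 3]; otherwise the other vertices form a
   clique of size [d.+1]. *)
Lemma STAB2_two_valued (R : realType) (m : nat) (e : rel 'I_m) (d : nat) (a b : R)
    (X : 'M[R]_m) :
  symmetric e -> irreflexive e -> (m <= d.+2)%N ->
  (forall C : {set 'I_m}, {in C &, forall i j, i != j -> e i j} -> (#|C| <= d)%N) ->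
  0 <= b -> b * d%:R <= a -> m%:R * a <= 1 ->
  (forall i j, X i j = if i == j then a else b * (~~ e i j)%:R) ->
  STAB2 e X.
Proof.
move=> e_sym e_irr md clique b0 bda ma1 XE.
pose N := coneighbours e.
have Nle i : (#|N i| <= #|[set~ i]|)%N.
  by apply/subset_leq_card/fintype.subsetP => j; rewrite !inE => /andP[].
have Cle (i : 'I_m) : (#|[set~ i]| <= d.+1)%N by rewrite cardsC1 card_ord; case: (m) md.
(* Only [d.+1] other vertices exist at most, so more than [d] coneighbours means all of them. *)
have Nfull i : (d < #|N i|)%N -> forall j, j != i -> ~~ e i j.
  move=> dN; have NE : N i = [set~ i].
    apply/eqP; rewrite eqEcard (leq_trans (Cle i) dN) andbT.
    by apply/fintype.subsetP => j; rewrite !inE => /andP[].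
  by move=> j ji; have : j \in N i by [rewrite NE !inE]; rewrite inE => /andP[].
have st0 : stable e finset.set0 by apply/stableP => i j; rewrite inE.
case: (@arg_maxnP _ finset.set0 (stable e) (fun S : {set 'I_m} => #|S|) st0) => T stT Tmax.
have degW n : (n <= d)%N -> b * n%:R <= a.
  by move=> nd; apply: le_trans bda; rewrite ler_wpM2l // ler_nat.
have [T3|T2] := ltnP 2 #|T|.
  apply: (STAB2_cover e_irr (Fam := pairs_and_block e T)) XE => //.
  - move=> S; rewrite !inE => /orP[/eqP->|]; first by rewrite stT (ltn_trans _ T3).
    by case/andP => /andP[/eqP-> ->].
  - by move=> i j ij; apply: pairs_and_block_cover.
  move=> i; apply: degW; have [iT|iT] := boolP (i \in T).
    have := pairs_and_block_degree_in e_sym e_irr stT T3 iT.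
    by move=> /leq_trans/(_ (Nle i))/leq_trans/(_ (Cle i)).
  apply: leq_trans (pairs_and_block_degree_out e_sym e_irr iT) _.
  (* A vertex outside [T] nonadjacent to all others could be added to the maximum stable set [T]. *)
  rewrite leqNgt; apply/negP => /Nfull iN.
  have : stable e (i |: T).
    apply/stableP => j k /setU1P[->|jT] /setU1P[->|kT].
    - by rewrite e_irr.
    - by apply: iN; apply: contraNneq iT => <-.
    - by rewrite e_sym; apply: iN; apply: contraNneq iT => <-.
    - exact: (stableP _ _ stT).
  by move/Tmax; rewrite cardsU1 iT add1n /= ltnn.
apply: (STAB2_cover e_irr (Fam := stable_pairs e)) XE => //.
- by move=> S; rewrite !inE => /andP[/eqP-> ->].
- move=> i j ij; rewrite stable_pairs_cover //.
  by case: (e i j); rewrite ?cards0 ?cards1.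
move=> i; apply: degW; apply: leq_trans (stable_pairs_degree e_sym e_irr i) _.
rewrite leqNgt; apply/negP => dN; have iN := Nfull i dN.
have : (#|N i| <= d)%N; last by rewrite leqNgt dN.
apply: clique => u w; rewrite !inE => /andP[ui _] /andP[wi _] uw.
(* A nonadjacent pair [u], [w] would form a stable triple with [i], while [T] has at most two
   elements. *)
apply/negPn/negP => nuw.
have : stable e (i |: [set u; w]).
  apply/stableP => j k /setU1P[->|+] /setU1P[->|+].
  - by rewrite e_irr.
  - by case/set2P=> ->; apply: iN.
  - by case/set2P=> ->; rewrite e_sym; apply: iN.
  - by case/set2P=> -> /set2P[]->; rewrite ?e_irr // e_sym.
move/Tmax; rewrite cardsU1 cards2 uw !inE eq_sym (negPf ui) eq_sym (negPf wi) /=.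
by rewrite leqNgt ltnS T2.
Qed.

(** * Cliques of the Paley graph and the collapse of the hierarchy *)

(** Multiplication by [g] negates [chi] on differences, turning edges inside the clique into
    nonedges. *)
Lemma paley_clique_le_alpha (R : realType) (F : finFieldType) (C : {set 'I_#|F|}) :
  #|F| = 1 %[mod 4] -> {in C &, forall i j, i != j -> paley F i j} ->
  (#|C| <= alpha (paley F))%N.
Proof.
move=> card1 cliqueC; have oddF := paley_odd card1.
have [g gN1] := exists_nonsquare R oddF.
have g0 : g != 0 by apply: contra_eq_neq gN1 => ->; rewrite quadc0 eq_sym oppr_eq0 oner_eq0.
pose f (i : 'I_#|F|) : 'I_#|F| := enum_rank (g * enum_val i).
have finj : injective f by move=> i j /enum_rank_inj/(mulfI g0)/enum_val_inj.
rewrite -(card_imset _ finj).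
apply: (@leq_bigmax_cond _ (stable (paley F)) (fun S => #|pred_of_set S|) (f @: C)).
apply/stableP => _ _ /imsetP[i iC ->] /imsetP[j jC ->].
have [->|ij] := eqVneq i j; first by rewrite paley_irrefl.
have fij : f i != f j by rewrite (inj_eq finj).
have := quadc_paley R fij; rewrite !enum_rankK -mulrBr quadcM // gN1.
rewrite quadc_paley // (cliqueC i j) //.
by case: (paley F (f i) (f j)); rewrite //= mulr1 => h; clear -h; lra.
Qed.

Lemma sup_max_elt (R : realType) (A : set R) (v : R) :
  A v -> ubound A v -> sup A = v.
Proof.
move=> Av ub; apply/eqP; rewrite eq_le ge_sup //=; last by exists v.
by apply: ub_le_sup => //; exists v.
Qed.

Theorem theorem16 (R : realType) (F : finFieldType) (q : nat) :
  #|F| = q -> (25 <= q)%N -> q = 1 %[mod 4] ->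
  (alpha (paley F) < ell R q)%N ->
  z R (ell R q + 1) (paley F) = z R (ell R q) (paley F)
  /\ z R (ell R q) (paley F) = theta R (paley F).
Proof.
move=> <- {q} q25 card1 alpha_ell.
have s0 := paley_s_gt0 R F; have s2 := paley_s_sqr R F.
have sum_opt : \sum_(i < #|F|) (const_mx (Num.sqrt #|F|%:R)^-1 : 'cV[R]_#|F|) i 0
    = Num.sqrt #|F|%:R.
  under eq_bigr do rewrite mxE.
  by rewrite sumr_const card_ord -[_ *+ _]mulr_natl -[X in X * _]s2 expr2 mulfK // gt_eqF.
have opt := paley_opt_feasible R card1.
have thetaE : theta R (paley F) = Num.sqrt #|F|%:R.
  apply: sup_max_elt; first by exists (paley_opt R F), (const_mx (Num.sqrt #|F|%:R)^-1).
  by move=> _ [X [x [fX ->]]]; exact: paley_theta_le fX.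
(* The optimum of [theta] is shown to remain feasible at all these levels. *)
suff zE k : (k <= ell R #|F| + 1)%N -> z R k (paley F) = Num.sqrt #|F|%:R.
  by rewrite !zE ?thetaE // leq_addr.
move=> kl; apply: sup_max_elt; last first.
  by move=> _ [X [x [fX _ ->]]]; exact: paley_theta_le fX.
exists (paley_opt R F), (const_mx (Num.sqrt #|F|%:R)^-1); split=> // I cardI.
move: s0 s2; set s := Num.sqrt _ => s0 s2.
(* Needed for the total weight: [d.+2] is at most [(s + 5) / 2], which is at most [s] exactly when
   [s] is at least [5]. *)
have s5 : 5%:R <= s.
  by rewrite -(ler_pXn2r (n := 2)) ?nnegrE ?ler0n ?(ltW s0) // s2 -natrX ler_nat.
have ell_le : (ell R #|F|)%:R <= (s + 3%:R) / 2%:R by rewrite /ell -/s truncn_le divr_ge0 //; lra.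
(* With [d] one less than [ell], [alpha_ell] bounds cliques by [d], and a subgraph of order
   [ell + 1] has [d.+2] vertices. *)
have [d ellE] : exists d, ell R #|F| = d.+1.
  by move: alpha_ell; case: (ell R #|F|) => // d _; exists d.
have mle : (#|I| <= d.+2)%N by rewrite cardI (leq_trans (geq_minl _ _)) // -ellE -addn1.
rewrite ellE -natr1 in ell_le.
apply: (@STAB2_two_valued _ _ _ d s^-1 (2%:R / (s * (s + 1)))) => //.
- by move=> i j; rewrite /induced paley_sym.
- by move=> i; rewrite /induced paley_irrefl.
- move=> C cliqueC; rewrite -ltnS -ellE; apply: leq_ltn_trans alpha_ell.
  rewrite -(card_imset _ (@enum_val_inj _ (mem I))).
  apply: (paley_clique_le_alpha R card1) => _ _ /imsetP[i iC ->] /imsetP[j jC ->] ij.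
  by apply: cliqueC => //; apply: contra_neq ij => ->.
- by rewrite divr_ge0 // mulr_ge0 //; lra.
(* The condition amounts to [2 * d <= s + 1], that is, [d + 1 <= (s + 3) / 2], the bound built into
   [ell]. *)
- rewrite invfM mulrA mulrAC ler_pdivrMr; last by lra.
  rewrite [X in X <= _](_ : _ = s^-1 * (2%:R * d%:R)); last by rewrite mulrA [2%:R * s^-1]mulrC -mulrA.
  by rewrite ler_pM2l ?invr_gt0 //; lra.
- rewrite ler_pdivrMr // mul1r.
  have : (#|I|%:R : R) <= d.+2%:R by rewrite ler_nat.
  by rewrite -[d.+2%:R]natr1 -[d.+1%:R]natr1; lra.
by move=> i j; rewrite mxE paley_optE (inj_eq enum_val_inj).
Qed.
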